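(* Let $\mathcal{G}$ be a family of finite simple graphs with maximum degree at most $4$ and with large girth. Then there is a Polynomial Approximation Scheme (PAS) for computing $\log Z(\lambda,G)$ with $\lambda=1$ (i.e. the logarithm of the number of independent sets of $G$) on the family $\mathcal{G}$. That is, for every $\epsilon>0$ there is a deterministic algorithm which for every $G\in\mathcal{G}$ produces an $\epsilon$-approximation of the log-partition function $\log Z(1,G)$ in time polynomial in the number $n$ of nodes of $G$.
   Context: For a finite simple graph $G$ with $n$ nodes, $\mathcal{I}(G)$ is the set of all independent sets of $G$ (including the empty set) and, for $\lambda>0$, $Z(\lambda,G)=\sum_{I\in\mathcal{I}(G)}\lambda^{|I|}$; in particular $Z(1,G)=|\mathcal{I}(G)|$. The girth $g(G)$ is the length of a shortest cycle of $G$ ($g(G)=\infty$ if $G$ has no cycles). An (infinite) family $\mathcal{G}$ of graphs has large girth if there is an increasing function $f:\mathbb{N}\to\mathbb{N}$ with $\lim_{s\to\infty}f(s)=\infty$ such that $g(G)\ge f(n)$ for every $G\in\mathcal{G}$ with $n$ nodes. A value $\alpha>0$ is an $\epsilon$-approximation of the log-partition function $\log Z(\lambda,G)$ if $(1-\epsilon)\frac{\log Z(\lambda,G)}{n}\le\alpha\le(1+\epsilon)\frac{\log Z(\lambda,G)}{n}$. A PAS for a family $\mathcal{G}$ is an algorithm that, for every error tolerance $\epsilon>0$ and every $G\in\mathcal{G}$, produces an $\epsilon$-approximation of the log-partition function of $G$ in time polynomial in $n$; the dependence of the running time on $\epsilon$ (and on the family $\mathcal{G}$) is arbitrary. *)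

(* Defs.v *)
From HB Require Import structures.
From mathcomp Require Import all_boot all_order all_algebra.
From mathcomp Require Import all_classical all_reals all_analysis.

Set Implicit Arguments.
Unset Strict Implicit.
Unset Printing Implicit Defensive.

Import Order.TTheory GRing.Theory Num.Theory.
Import numFieldNormedType.Exports.

Local Open Scope classical_set_scope.
Local Open Scope ring_scope.

Record sgraph := SGraph {
  nnodes : nat;
  edge : rel 'I_nnodes;
  edge_sym : symmetric edge;
  edge_irrefl : irreflexive edge }.

Definition max_degree (G : sgraph) : nat :=
  \max_(x : 'I_(nnodes G)) #|[set y | edge x y]%SET|.

Definition indep_sets (G : sgraph) : {set {set 'I_(nnodes G)}} :=
  [set I : {set 'I_(nnodes G)} |
    [forall x in I, forall y in I, ~~ edge x y]]%SET.

Definition partition_function (R : realType) (lambda : R) (G : sgraph) : R :=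
  \sum_(I in indep_sets G) lambda ^+ #|I|.

(* The bound on the size excludes the degenerate closed walks x and x, y, which
   [ucycle] accepts for a symmetric relation. *)
Definition graph_cycle (G : sgraph) (c : seq 'I_(nnodes G)) : Prop :=
  ucycle (@edge G) c /\ (2 < size c)%N.

(* The infimum of the empty set is +oo, which is the girth of a forest. *)
Definition girth (R : realType) (G : sgraph) : \bar R :=
  ereal_inf [set (size c)%:R%:E | c in @graph_cycle G].

(* "Increasing" has to be read weakly: a strictly increasing f would satisfy
   n <= f n. *)
Definition large_girth (R : realType) (F : set sgraph) : Prop :=
  exists f : nat -> nat,
    [/\ {homo f : m n / (m <= n)%N},
        f @ \oo --> \oo
      & forall G, F G -> ((f (nnodes G))%:R%:E <= girth R G)%E].

Definition eps_approx (R : realType) (eps lambda : R) (G : sgraph)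
    (alpha : R) : Prop :=
  let h := ln (partition_function lambda G) / (nnodes G)%:R in
  [/\ 0 < alpha, (1 - eps) * h <= alpha & alpha <= (1 + eps) * h].

(* Algorithms are programs of a random access machine with registers and a
   memory, both holding natural numbers, in the style of Cook and Reckhow but
   with structured control.  Every elementary instruction and every test takes
   one unit of time.  Sums and truncated differences are the only arithmetic, so
   that t steps lengthen the numbers by at most t bits; this is why the uniform
   cost yields the polynomial time of Turing machines. *)
Inductive cmd :=
  | Skip
  | Const of nat & nat            (* r := c *)
  | Add of nat & nat & nat        (* r := r1 + r2 *)
  | Sub of nat & nat & nat        (* r := r1 - r2, truncated *)
  | Fetch of nat & nat            (* r := cells[r1] *)
  | Store of nat & nat            (* cells[r1] := r2 *)
  | Seq of cmd & cmd
  | If of nat & cmd & cmd         (* first branch when r <> 0 *)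
  | While of nat & cmd.           (* loop as long as r <> 0 *)

Record state := State { regs : nat -> nat; cells : nat -> nat }.

Definition set_reg (s : state) (r v : nat) : state :=
  State [eta regs s with r |-> v] (cells s).

Definition set_mem (s : state) (a v : nat) : state :=
  State (regs s) [eta cells s with a |-> v].

(* [exec c s t s'] : started in s, the command c halts in s' after t steps. *)
Inductive exec : cmd -> state -> nat -> state -> Prop :=
  | ExecSkip s : exec Skip s 1 s
  | ExecConst r c s : exec (Const r c) s 1 (set_reg s r c)
  | ExecAdd r r1 r2 s :
      exec (Add r r1 r2) s 1 (set_reg s r (regs s r1 + regs s r2)%N)
  | ExecSub r r1 r2 s :
      exec (Sub r r1 r2) s 1 (set_reg s r (regs s r1 - regs s r2)%N)
  | ExecFetch r r1 s : exec (Fetch r r1) s 1 (set_reg s r (cells s (regs s r1)))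
  | ExecStore r1 r2 s : exec (Store r1 r2) s 1 (set_mem s (regs s r1) (regs s r2))
  | ExecSeq c1 c2 s1 s2 s3 t1 t2 :
      exec c1 s1 t1 s2 -> exec c2 s2 t2 s3 -> exec (Seq c1 c2) s1 (t1 + t2)%N s3
  | ExecIfT r c1 c2 s s' t :
      regs s r != 0%N -> exec c1 s t s' -> exec (If r c1 c2) s t.+1 s'
  | ExecIfF r c1 c2 s s' t :
      regs s r = 0%N -> exec c2 s t s' -> exec (If r c1 c2) s t.+1 s'
  | ExecWhileT r c s1 s2 s3 t1 t2 :
      regs s1 r != 0%N -> exec c s1 t1 s2 -> exec (While r c) s2 t2 s3 ->
      exec (While r c) s1 (t1 + t2).+1%N s3
  | ExecWhileF r c s : regs s r = 0%N -> exec (While r c) s 1 s.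

Lemma exec_det c s t1 s1 t2 s2 :
  exec c s t1 s1 -> exec c s t2 s2 -> t1 = t2 /\ s1 = s2.
Proof.
move=> H; elim: H t2 s2 => {c s t1 s1}; intros;
match goal with H : exec _ _ ?t ?s |- _ = ?t /\ _ = ?s =>
  inversion H; subst; clear H end => //;
repeat match goal with
| H1 : is_true (?x != 0%N), H2 : ?x = 0%N |- _ => by rewrite H2 in H1
| IH : (forall t s, exec ?c ?s0 t s -> _), H : exec ?c ?s0 _ _ |- _ =>
    case: (IH _ _ H) => ? ?; subst; clear H
end; by [].
Qed.

(* The number n of nodes is in register 0, the n x n adjacency matrix is stored
   row by row from address 0 on, and everything else is 0. *)
Definition input (G : sgraph) : state :=
  State [eta fun=> 0%N with 0%N |-> nnodes G]
    (nth 0%N [seq nat_of_bool (edge x y) |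
               x <- enum 'I_(nnodes G), y <- enum 'I_(nnodes G)]).

(* Numbers are output as fractions; a zero denominator gives 0, which is never
   an approximation since those are positive. *)
Definition output (R : realType) (s : state) : R :=
  (regs s 0)%:R / (regs s 1)%:R.

(* The notion of approximation divides by the number of nodes, so the graph
   without nodes is excluded. *)
Definition has_PAS (R : realType) (lambda : R) (F : set sgraph) : Prop :=
  forall eps : R, 0 < eps ->
  exists (A : cmd) (c k : nat), forall G, F G -> (0 < nnodes G)%N ->
  exists (t : nat) (s : state),
    [/\ exec A (input G) t s,
        (t <= c * nnodes G ^ k)%N
      & eps_approx eps lambda G (output R s)].

(* Main.v *)
Require Import Defs.
From HB Require Import structures.
From mathcomp Require Import all_boot all_order all_algebra.
From mathcomp Require Import all_classical all_reals all_analysis.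
From mathcomp Require Import zify lra.

Set Implicit Arguments.
Unset Strict Implicit.
Unset Printing Implicit Defensive.

Import Order.TTheory GRing.Theory Num.Theory.
Import numFieldNormedType.Exports.

Local Open Scope classical_set_scope.
Local Open Scope ring_scope.

(** Write Z(H) for the number of independent sets of G inside a set H of nodes,
    and call vacancy of v in H the ratio p(H, v) = Z(H - v) / Z(H), the
    probability that a uniform independent set inside H avoids v.  Deleting the
    nodes one at a time writes Z(G) as a telescoping product of such ratios, so
    that log Z(G) is the sum of the numbers - log p(H_v, v), where H_v consists
    of the nodes that are at least v.  Each of these terms is at least 1/17, as
    p <= 16/17 in degree at most 4 [ln_vacancy_ge]; hence it suffices to know
    every single term up to an additive error of epsilon / 17.

    Deleting v and then its neighbours w_1, w_2, ... in turn gives the exact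
    recursion p = 1 / (1 + p_1 p_2 ...), where p_i is the vacancy of w_i once v
    and the earlier neighbours are gone [vacancy_rec].  From the second level
    on, a node has lost the neighbour through which it was reached, so at most
    three factors occur.  All vacancies lie in [1/2, 1], and there the map
    (x, y, z) |-> 1 / (1 + x y z) contracts the sup norm by the factor 24/25
    [inv1D_contracting]: this is the decay of correlations, and it is the place
    where activity 1 and degree 4 matter.  Cutting the recursion at a depth t
    that depends on epsilon only therefore costs an error that is geometric in t
    [approx_error].

    The vacancies are rounded to multiples of 1/M for a constant M, so that
    multiplication, inversion and logarithm are functions on {0, ..., M} and can
    be hard-wired into a program as finite case distinctions [lookup].  A
    recursion of constant depth t unfolds into t + 1 nested loops over the
    nodes, the body of each costing a constant number of steps besides the inner
    loop [vacancy_prog_ok, logZ_prog_ok]; so the running time is polynomial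
    [vacancy_time_poly]. *)

(** * The contraction *)

Lemma affine_ge0 (R : realFieldType) (f : R -> R) (p q x : R) :
  (forall y, f y = p + q * y) -> 0 <= f (1 / 2) -> 0 <= f 1 ->
  1 / 2 <= x <= 1 -> 0 <= f x.
Proof.
move=> fE; rewrite !fE => h2 h1 /andP[x2 x1].
have -> : p + q * x =
    (p + q * (1 / 2)) * (2 * (1 - x)) + (p + q * 1) * (2 * x - 1) by lra.
by rewrite addr_ge0 // mulr_ge0 //; lra.
Qed.

(** Dividing by d leaves a polynomial that is affine in each of a, b and c.  The
    product (1 + A) (1 + B) on the right, with A = a b c, is not; but A >= 1/8 and
    B >= A give (A - 1/8) (B - 1/8) >= 0, hence the lower bound
    63/64 + 9/8 (A + B), which is affine in each variable again; so it is
    enough to look at the vertices of the cube.  The point (1, 1, 1/2) shows, as d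
    tends to 0, that no constant below 8/9 would do; 24/25 pays for the affine
    bound. *)
Lemma triple_product_gap (R : realFieldType) (a b c d : R) :
  1 / 2 <= a <= 1 -> 1 / 2 <= b <= 1 -> 1 / 2 <= c <= 1 -> 0 <= d <= 1 / 2 ->
  (a + d) * (b + d) * (c + d) - a * b * c <=
    24 / 25 * d * ((1 + a * b * c) * (1 + (a + d) * (b + d) * (c + d))).
Proof.
move=> ha hb hc /andP[d0 d2].
have ab4 : 1 / 4 <= a * b by nra.
have A8 : 1 / 8 <= a * b * c by nra.
have AB : a * b * c <= (a + d) * (b + d) * (c + d).
  have ? : a * b <= (a + d) * (b + d) by nra.
  by apply: ler_pM => //; lra.
pose gap x y z := 24 / 25 * (63 / 64 + 9 / 8 *
     (x * y * z + (x + d) * (y + d) * (z + d)))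
     - (x * y + y * z + z * x + d * (x + y + z) + d ^+ 2).
suff : 0 <= gap a b c.
  rewrite /gap subr_ge0 => {}gap.
  move: A8 AB gap; set A := a * b * c; set B := _ * _ * (c + d) => A8 AB gap.
  have -> : B - A = d * (a * b + b * c + c * a + d * (a + b + c) + d ^+ 2).
    by rewrite /A /B; lra.
  rewrite (_ : 24 / 25 * d * _ = d * (24 / 25 * ((1 + A) * (1 + B)))); last lra.
  have AB8 : 0 <= (A - 1 / 8) * (B - 1 / 8) by apply: mulr_ge0; lra.
  by rewrite ler_wpM2l //; apply: (le_trans gap); lra.
(* By the symmetry of gap, affinity in the last variable is enough. *)
have gap1 x y : 0 <= gap x y (1 / 2) -> 0 <= gap x y 1 ->
    forall z, 1 / 2 <= z <= 1 -> 0 <= gap x y z.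
  move=> h2 h1 z; apply: (affine_ge0 (p := gap x y 0)
    (q := gap x y 1 - gap x y 0)) h2 h1 => t; rewrite /gap; lra.
have gapC x y z : gap x y z = gap y z x by rewrite /gap; lra.
have gapT x y z : gap x y z = gap y x z by rewrite /gap; lra.
have d22 : 0 <= d ^+ 2 by rewrite sqr_ge0.
have d33 : 0 <= d ^+ 3 by rewrite exprn_ge0.
have vert0 : 0 <= gap (1 / 2) (1 / 2) (1 / 2) by rewrite /gap; nra.
have vert1 : 0 <= gap 1 (1 / 2) (1 / 2) by rewrite /gap; nra.
(* The tightest of the four vertices; its gap is smallest near d = 1/10. *)
have vert2 : 0 <= gap 1 1 (1 / 2).
  rewrite /gap; have := sqr_ge0 (d - 1 / 10).
  nra.
have vert3 : 0 <= gap 1 1 1 by rewrite /gap; nra.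
apply: (gap1 a b) hc; rewrite gapC; apply: (gap1 b _) ha;
  rewrite gapC; apply: (gap1 _ _) hb => //.
all: by rewrite ?(gapT (1 / 2) 1) // gapC // gapC.
Qed.

Lemma inv1D_sub (R : realFieldType) (x y : R) : 0 <= x -> 0 <= y ->
  (1 + x)^-1 - (1 + y)^-1 = (y - x) / ((1 + x) * (1 + y)).
Proof.
move=> x0 y0.
have x1 : 1 + x != 0 by rewrite gt_eqF //; lra.
have y1 : 1 + y != 0 by rewrite gt_eqF //; lra.
apply: (mulIf (mulf_neq0 x1 y1)); rewrite divfK ?mulf_neq0 // mulrBl.
by rewrite mulKf // [(1 + x) * _]mulrC mulKf //; lra.
Qed.

(** By monotonicity the worst case raises all three factors by the same d.  This
    may leave the interval [1/2, 1], which is why [triple_product_gap] does not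
    confine a + d, b + d and c + d to it. *)
Lemma prod_gap_le (R : realFieldType) (a b c a' b' c' d : R) :
  1 / 2 <= a <= 1 -> 1 / 2 <= b <= 1 -> 1 / 2 <= c <= 1 ->
  0 <= a' -> 0 <= b' -> 0 <= c' -> 0 <= d <= 1 / 2 ->
  a' <= a + d -> b' <= b + d -> c' <= c + d ->
  (1 + a * b * c)^-1 - (1 + a' * b' * c')^-1 <= 24 / 25 * d.
Proof.
move=> ha hb hc a0 b0 c0 hd aa bb cc.
have gap := triple_product_gap ha hb hc hd.
move: ha hb hc => /andP[ha _] /andP[hb _] /andP[hc _].
have P0 : 0 <= a * b * c by apply: mulr_ge0; [apply: mulr_ge0|]; lra.
have P'0 : 0 <= a' * b' * c' by apply: mulr_ge0; [apply: mulr_ge0|].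
have PP : a' * b' * c' <= (a + d) * (b + d) * (c + d).
  by apply: ler_pM => //; [apply: mulr_ge0|apply: ler_pM].
move: (a * b * c) (a' * _ * _) (_ * _ * (c + d)) P0 P'0 PP gap.
move=> P P' Q P0 P'0 PP gap.
apply: (@le_trans _ _ ((1 + P)^-1 - (1 + Q)^-1)).
  by rewrite lerD2l lerN2 lef_pV2 ?lerD2l // posrE; lra.
rewrite inv1D_sub //; last lra.
by rewrite ler_pdivrMr // mulr_gt0 //; lra.
Qed.

(** The map P |-> 1 / (1 + P) is decreasing, so the two one-sided bounds come
    from [prod_gap_le] with the roles of f and g exchanged. *)
Lemma inv1D_contracting (R : realFieldType) (I : eqType) (s : seq I)
    (f g : I -> R) (d : R) :
  (size s <= 3)%N ->
  {in s, forall i, 1 / 2 <= f i <= 1} -> {in s, forall i, 1 / 2 <= g i <= 1} ->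
  {in s, forall i, `|f i - g i| <= d} -> 0 <= d ->
  `|(1 + \prod_(i <- s) f i)^-1 - (1 + \prod_(i <- s) g i)^-1| <= 24 / 25 * d.
Proof.
move=> s3 hf hg hfg d0.
(* Two numbers of [1/2, 1] never differ by more than 1/2. *)
pose e := Num.min d (1 / 2).
have e0 : 0 <= e <= 1 / 2 by rewrite /e; case: (ltP d) => ?; lra.
suff le_e : `|(1 + \prod_(i <- s) f i)^-1 - (1 + \prod_(i <- s) g i)^-1| <=
    24 / 25 * e.
  have : e <= d by rewrite ge_min lexx.
  lra.
have {hfg} : {in s, forall i, `|f i - g i| <= e}.
  move=> i si; rewrite le_min hfg //=; have := hf _ si; have := hg _ si.
  by rewrite ler_norml; lra.
have one : 1 / 2 <= (1 : R) <= 1 by lra.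
have three (a b c a' b' c' : R) :
    1 / 2 <= a <= 1 -> 1 / 2 <= b <= 1 -> 1 / 2 <= c <= 1 ->
    1 / 2 <= a' <= 1 -> 1 / 2 <= b' <= 1 -> 1 / 2 <= c' <= 1 ->
    `|a - a'| <= e -> `|b - b'| <= e -> `|c - c'| <= e ->
    `|(1 + a * b * c)^-1 - (1 + a' * b' * c')^-1| <= 24 / 25 * e.
  move=> ha hb hc ha' hb' hc'; rewrite !ler_norml => haa hbb hcc.
  rewrite lerNl opprB; apply/andP.
  by split; apply: prod_gap_le => //; lra.
have sub1 : `|(1 : R) - 1| <= e by rewrite subrr normr0; lra.
(* A missing child counts as a factor 1. *)
case: s s3 hf hg => [|i [|j [|k [|//]]]] _ hf hg hfg.
- rewrite !big_nil; have := three 1 1 1 1 1 1; rewrite !mulr1; exact.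
- have si : i \in [:: i] by rewrite inE.
  have := three (f i) 1 1 (g i) 1 1; rewrite !mulr1 !big_seq1; by auto.
- have si : i \in [:: i; j] by rewrite inE eqxx.
  have sj : j \in [:: i; j] by rewrite !inE eqxx orbT.
  rewrite !big_cons !big_nil !mulrA; by apply: three; auto.
- have si : i \in [:: i; j; k] by rewrite inE eqxx.
  have sj : j \in [:: i; j; k] by rewrite !inE eqxx orbT.
  have sk : k \in [:: i; j; k] by rewrite !inE eqxx !orbT.
  rewrite !big_cons !big_nil !mulr1 !mulrA; by apply: three; auto.
Qed.

Lemma prod_dist (R : realFieldType) (I : eqType) (s : seq I)
    (f g : I -> R) (d : R) :
  {in s, forall i, 0 <= f i <= 1} -> {in s, forall i, 0 <= g i <= 1} ->
  {in s, forall i, `|f i - g i| <= d} ->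
  `|\prod_(i <- s) f i - \prod_(i <- s) g i| <= (size s)%:R * d.
Proof.
elim: s => [|i s IH] hf hg hfg; first by rewrite !big_nil subrr normr0 mul0r.
have si : i \in i :: s by rewrite inE eqxx.
have ss j : j \in s -> j \in i :: s by rewrite inE orbC => ->.
have {}IH : `|\prod_(i <- s) f i - \prod_(i <- s) g i| <= (size s)%:R * d.
  by apply: IH => j sj; auto.
rewrite !big_cons /= -natr1 mulrDl mul1r [leRHS]addrC.
have P1 : `|\prod_(i <- s) f i| <= 1.
  rewrite ger0_norm; last first.
    by rewrite big_seq prodr_ge0 // => j /ss /hf /andP[].
  by rewrite big_seq; apply: prodr_ile1 => j /ss /hf.
have -> : f i * \prod_(i <- s) f i - g i * \prod_(i <- s) g i =
  (f i - g i) * \prod_(i <- s) f i +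
  g i * (\prod_(i <- s) f i - \prod_(i <- s) g i) by lra.
apply: (le_trans (ler_normD _ _)); rewrite !normrM lerD //.
  by rewrite -[leRHS]mulr1 ler_pM // hfg.
rewrite -[leRHS]mul1r ler_pM // ger0_norm; have /andP[] := hg _ si => //.
Qed.

Lemma inv1D_lipschitz (R : realFieldType) (x y : R) :
  0 <= x -> 0 <= y -> `|(1 + x)^-1 - (1 + y)^-1| <= `|x - y|.
Proof.
move=> x0 y0.
rewrite inv1D_sub // normrM distrC ler_piMr // normfV ger0_norm; last by apply: mulr_ge0; lra.
by rewrite invf_le1; [|apply: mulr_gt0; lra]; nra.
Qed.

(** * Vacancies *)

Definition nbrs (G : sgraph) (v : 'I_(nnodes G)) : {set 'I_(nnodes G)} :=
  [set y | edge v y]%SET.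

Definition indeps_in (G : sgraph) (H : {set 'I_(nnodes G)}) :=
  [set I in indep_sets G | I \subset H]%SET.

Lemma indeps_in_gt0 (G : sgraph) (H : {set 'I_(nnodes G)}) :
  (0 < #|indeps_in H|)%N.
Proof.
apply/card_gt0P; exists finset.set0; rewrite !inE finset.sub0set andbT.
by apply/forall_inP => x; rewrite inE.
Qed.

Lemma indeps_inS (G : sgraph) (H K : {set 'I_(nnodes G)}) :
  H \subset K -> (#|indeps_in H| <= #|indeps_in K|)%N.
Proof.
move=> HK; apply/subset_leq_card/fintype.subsetP => I.
by rewrite !inE => /andP[-> /=] /fintype.subset_trans; apply.
Qed.

(** An independent set that contains v is v together with an independent set
    avoiding v and its neighbours. *)
Lemma card_indeps_inD1 (G : sgraph) (H : {set 'I_(nnodes G)}) v : v \in H ->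
  #|indeps_in H| = (#|indeps_in (H :\ v)| + #|indeps_in (H :\ v :\: nbrs v)|)%N.
Proof.
move=> vH; rewrite -(cardsID [set I : {set 'I_(nnodes G)} | v \in I]%SET) addnC.
congr addn.
  apply: eq_card => I; rewrite !inE finset.subsetD1.
  by case: (v \in I); rewrite ?andbT ?andbF.
have addK : {in indeps_in (H :\ v :\: nbrs v), cancel (fun I => v |: I)%SET
    (fun I => I :\ v)%SET}.
  move=> I; rewrite inE => /andP[_ /fintype.subsetP IH]; apply: setU1K.
  by apply/negP => /IH; rewrite !inE eqxx !andbF.
rewrite -(card_in_imset (can_in_inj addK)); apply: eq_card => I.
rewrite !inE; apply/andP/imsetP => [[/andP[/forall_inP Iind IH] vI]|[J]].
  exists (I :\ v); last by rewrite finset.setD1K.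
  rewrite !inE; apply/andP; split.
    apply/forall_inP => x; rewrite inE => /andP[_ xI].
    apply/forall_inP => y; rewrite inE => /andP[_ yI].
    by have /forall_inP := Iind _ xI; apply.
  apply/fintype.subsetP => x; rewrite !inE => /andP[xv xI].
  rewrite xv (fintype.subsetP IH _ xI) !andbT.
  by have /forall_inP := Iind _ vI; apply.
rewrite !inE => /andP[/forall_inP Jind /fintype.subsetP JH] ->.
have Jv y : y \in J -> ~~ edge v y by move/JH; rewrite !inE => /andP[].
split; last by rewrite !inE eqxx.
apply/andP; split.
  apply/forall_inP => x; rewrite !inE => /orP[/eqP->|xJ];
    apply/forall_inP => y; rewrite !inE => /orP[/eqP->|yJ].
  - by rewrite edge_irrefl.
  - exact: Jv.
  - by rewrite edge_sym Jv.
  - by have /forall_inP := Jind _ xJ; apply.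
apply/fintype.subsetP => x; rewrite !inE => /orP[/eqP->//|/JH].
by rewrite !inE => /andP[_ /andP[]].
Qed.

Definition vacancy (R : realType) (G : sgraph) (H : {set 'I_(nnodes G)}) v : R :=
  #|indeps_in (H :\ v)|%:R / #|indeps_in H|%:R.

(** The recursion at v meets the neighbours of v in increasing order.  For
    m = w this is the set in which the neighbour w is considered; m is a plain
    number so that it can run up to the number of nodes, where no neighbour is
    left. *)
Definition rest (G : sgraph) (H : {set 'I_(nnodes G)}) (v : 'I_(nnodes G))
    (m : nat) : {set 'I_(nnodes G)} :=
  [set x in H | (x != v) && ~~ (edge v x && (x < m)%N)]%SET.

Definition children (G : sgraph) (H : {set 'I_(nnodes G)}) v :=
  [seq w <- enum 'I_(nnodes G) | edge v w && (w \in H)].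

Lemma children_rest (G : sgraph) (H : {set 'I_(nnodes G)}) v w :
  w \in children H v -> w \in rest H v w.
Proof.
rewrite mem_filter => /andP[/andP[vw wH] _]; rewrite !inE wH ltnn andbF andbT /=.
by apply: contraTneq vw => ->; rewrite edge_irrefl.
Qed.

Lemma size_children (G : sgraph) (H : {set 'I_(nnodes G)}) v :
  (size (children H v) <= max_degree G)%N.
Proof.
apply: leq_trans (leq_bigmax v); have /card_uniqP <- : uniq (children H v).
  by rewrite filter_uniq // enum_uniq.
apply/subset_leq_card/fintype.subsetP => x.
by rewrite mem_filter inE => /andP[/andP[]].
Qed.

(** The neighbour v of w is no longer there. *)
Lemma size_children_rest (G : sgraph) (H : {set 'I_(nnodes G)}) v w m :
  w \in children H v -> (size (children (rest H v m) w) < max_degree G)%N.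
Proof.
rewrite mem_filter => /andP[/andP[vw _] _].
apply: leq_trans (leq_bigmax w); have /card_uniqP <- : uniq (children (rest H v m) w).
  by rewrite filter_uniq // enum_uniq.
rewrite -[X in (_ < X)%N](cardsID [set v]%SET) finset.setIC (finset.setIidPl _); last first.
  by apply/fintype.subsetP => x; rewrite !inE => /eqP->; rewrite edge_sym.
rewrite cards1 add1n ltnS; apply/subset_leq_card/fintype.subsetP => x.
by rewrite mem_filter !inE => /andP[/andP[-> /andP[_ /andP[->]]]].
Qed.

(** The m-th factor is the ratio of the numbers of independent sets in two
    consecutive sets [rest H v m.+1] and [rest H v m], so the product
    telescopes. *)
Lemma prod_vacancy (R : realType) (G : sgraph) (H : {set 'I_(nnodes G)}) v m :
  (m <= nnodes G)%N ->
  \prod_(w <- take m (enum 'I_(nnodes G)) | edge v w && (w \in H))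
     vacancy R (rest H v w) w =
  #|indeps_in (rest H v m)|%:R / #|indeps_in (rest H v 0)|%:R.
Proof.
elim: m => [_|m IH mn].
  by rewrite take0 big_nil divff // pnatr_eq0 -lt0n indeps_in_gt0.
have sm : (m < size (enum 'I_(nnodes G)))%N by rewrite size_enum_ord.
rewrite (take_nth v sm) -cats1 big_cat big_cons big_nil /=.
rewrite IH 1?ltnW // mulr1.
have := nth_enum_ord v mn; move: (nth v _ m) => w wm.
have restS : rest H v m.+1 = if edge v w && (w \in H) then rest H v m :\ w
    else rest H v m.
  apply/finset.setP => x; rewrite -wm.
  have [->|xw] := eqVneq x w.
    case: ifP; rewrite !inE ?eqxx ltnS leqnn ltnn !andbT ?andbF.
      by move=> /andP[-> _]; rewrite !andbF.
    by case: (edge v w); rewrite /= ?andbT // => ->.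
  suff -> : (x \in rest H v w.+1) = (x \in rest H v w).
    by case: ifP => // _; rewrite finset.in_setD1 xw.
  rewrite !inE ltnS leq_eqVlt; suff -> : (x == w :> nat) = false by [].
  by apply/negbTE.
rewrite restS; case: ifP => _; last by rewrite mulr1.
rewrite /vacancy wm mulrC mulrA divfK //.
by rewrite pnatr_eq0 -lt0n indeps_in_gt0.
Qed.

(** By [card_indeps_inD1], 1 / p = 1 + Z(H - v - N(v)) / Z(H - v), and
    [prod_vacancy] factors this quotient. *)
Lemma vacancy_rec (R : realType) (G : sgraph) (H : {set 'I_(nnodes G)}) v :
  v \in H ->
  vacancy R H v = (1 + \prod_(w <- children H v) vacancy R (rest H v w) w)^-1.
Proof.
move=> vH; rewrite big_filter.
have := prod_vacancy R H v (leqnn _).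
rewrite take_oversize ?size_enum_ord // => ->.
have -> : rest H v 0 = H :\ v.
  by apply/finset.setP => x; rewrite !inE ltn0 andbF andbT andbC.
have -> : rest H v (nnodes G) = H :\ v :\: nbrs v.
  by apply/finset.setP => x; rewrite !inE ltn_ord andbT [RHS]andbC -andbA andbCA.
rewrite /vacancy (card_indeps_inD1 vH) natrD -invf_div.
by rewrite mulrDl divff // pnatr_eq0 -lt0n indeps_in_gt0.
Qed.

Lemma vacancy_itv (R : realType) (G : sgraph) (H : {set 'I_(nnodes G)}) v :
  v \in H -> 1 / 2 <= vacancy R H v <= 1.
Proof.
move=> vH; have Zgt0 : 0 < #|indeps_in H|%:R :> R.
  by rewrite ltr0n indeps_in_gt0.
rewrite /vacancy ler_pdivlMr // ler_pdivrMr // [1 * #|_|%:R]mul1r ler_nat.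
rewrite (indeps_inS (finset.subD1set _ _)) andbT (card_indeps_inD1 vH).
have : (#|indeps_in (H :\ v :\: nbrs v)| <= #|indeps_in (H :\ v)|)%N.
  exact/indeps_inS/finset.subsetDl.
by rewrite -(ler_nat R) natrD; lra.
Qed.

(** * The truncated recursion *)

Definition round_mul (M P k : nat) : nat := (P * k %/ M)%N.
Definition round_inv (M P : nat) : nat := (M * M %/ (M + P))%N.

(** A number k stands for the vacancy k / M.  At the bottom any value in
    [1/2, 1] would serve. *)
Fixpoint approx (M t : nat) (G : sgraph) (H : {set 'I_(nnodes G)}) v : nat :=
  if t is t'.+1 then
    round_inv M (foldl (fun P (w : 'I_(nnodes G)) =>
                          round_mul M P (approx M t' (rest H v w) w)) M
                       (children H v))
  else M.

Lemma divn_floor (R : realFieldType) (a b : nat) : (0 < b)%N ->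
  a%:R / b%:R - 1 <= ((a %/ b)%:R : R) <= a%:R / b%:R.
Proof.
move=> b0; have b0' : 0 < b%:R :> R by rewrite ltr0n.
rewrite lerBlDr ler_pdivlMr // ler_pdivrMr // natr1 -!natrM !ler_nat.
by rewrite leq_divM andbT ltnW // ltn_ceil.
Qed.

Lemma leq_div_mul (m n d : nat) : (0 < d)%N -> (m <= n * d -> m %/ d <= n)%N.
Proof. by move=> d0 mn; rewrite -(mulnK n d0) leq_div2r. Qed.

Lemma round_mul_le (M P k : nat) :
  (P <= M)%N -> (k <= M)%N -> (round_mul M P k <= M)%N.
Proof.
case: M => [|M] PM kM; first by rewrite /round_mul divn0.
by apply: leq_div_mul => //; apply: leq_mul.
Qed.

Lemma foldl_round_mul_le (M : nat) (I : Type) (s : seq I) (f : I -> nat) P :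
  (forall i, f i <= M)%N -> (P <= M)%N ->
  (foldl (fun P i => round_mul M P (f i)) P s <= M)%N.
Proof. by move=> fM; elim: s P => //= i s IH P PM; apply/IH/round_mul_le. Qed.

Lemma approx_le (M t : nat) (G : sgraph) (H : {set 'I_(nnodes G)}) v :
  (approx M t H v <= M)%N.
Proof.
case: t => //= t; rewrite /round_inv; case: (posnP M) => [->|M0]; first by rewrite div0n.
by apply: leq_div_mul; [rewrite addn_gt0 M0|rewrite leq_mul // leq_addr].
Qed.

(** For even M the bound 1/2 is itself a multiple of 1/M, so that rounding down
    respects it. *)
Lemma approx_ge (M t : nat) (G : sgraph) (H : {set 'I_(nnodes G)}) v :
  ~~ odd M -> (M./2 <= approx M t H v)%N.
Proof.
move=> Meven; case: t => [|t] /=; first by rewrite -divn2 leq_div.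
rewrite /round_inv; case: (posnP M) => [->|M0]; first by rewrite div0n.
rewrite leq_divRL ?addn_gt0 ?M0 //.
have -> : (M * M = M./2 * (M + M))%N.
  by rewrite addnn -doubleMr doubleMl even_halfK.
rewrite leq_mul2l leq_add2l.
by rewrite foldl_round_mul_le ?orbT // => w; apply: approx_le.
Qed.

Lemma approx_itv (R : realFieldType) (M t : nat) (G : sgraph)
    (H : {set 'I_(nnodes G)}) v : (0 < M)%N -> ~~ odd M ->
  1 / 2 <= ((approx M t H v)%:R / M%:R : R) <= 1.
Proof.
move=> M0 Meven; have M0' : 0 < M%:R :> R by rewrite ltr0n.
rewrite ler_pdivlMr // ler_pdivrMr // [1 * M%:R]mul1r ler_nat approx_le andbT.
have ME : M%:R = M./2%:R * 2 :> R.
  by rewrite -[in LHS](even_halfK Meven) -muln2 natrM.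
by have := approx_ge t H v Meven; rewrite -(ler_nat R); lra.
Qed.

Lemma foldl_round_mul (R : realFieldType) (M : nat) (I : eqType) (s : seq I)
    (f : I -> nat) : (0 < M)%N -> (forall i, f i <= M)%N ->
  `|(foldl (fun P i => round_mul M P (f i)) M s)%:R / M%:R
    - \prod_(i <- s) ((f i)%:R / M%:R)| <= (size s)%:R / M%:R :> R.
Proof.
move=> M0 fM; have M0' : 0 < M%:R :> R by rewrite ltr0n.
have fM' i : 0 <= ((f i)%:R / M%:R : R) <= 1.
  by rewrite divr_ge0 ?ler0n //= ler_pdivrMr // mul1r ler_nat.
elim/last_ind: s => [|s i IH].
  by rewrite big_nil /= divff ?subrr ?normr0 ?mul0r // gt_eqF.
rewrite foldl_rcons -cats1 big_cat big_seq1 size_cat /=.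
move: (foldl _ _ _) IH => P; set X := \prod_(_ <- _) _; set x := (f i)%:R / M%:R => IH.
have := divn_floor R (P * f i) M0; rewrite -/(round_mul M P (f i)).
set y := (round_mul _ _ _)%:R; rewrite natrM => hy.
have /andP[x0 x1] : 0 <= x <= 1 := fM' i.
have xE : P%:R * (f i)%:R / M%:R = P%:R / M%:R * x * M%:R :> R.
  by rewrite -mulrA -/x mulrAC divfK ?gt_eqF.
rewrite {}xE in hy.
move: (P%:R / M%:R) IH hy => p IH hy.
have yp : `|y / M%:R - p * x| <= 1 / M%:R.
  have -> : y / M%:R - p * x = (y - p * x * M%:R) / M%:R.
    by rewrite mulrBl mulfK ?gt_eqF.
  rewrite normrM normfV (ger0_norm (ltW M0')) ler_wpM2r // ?invr_ge0 ?ler0n.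
  by rewrite ler_norml; lra.
rewrite addn1 -natr1 mulrDl [leRHS]addrC.
have -> : y / M%:R - X * x = (y / M%:R - p * x) + (p - X) * x by lra.
apply: (le_trans (ler_normD _ _)); apply: lerD => //.
rewrite normrM (ger0_norm x0); apply: le_trans IH.
by rewrite ler_piMr.
Qed.


(** Rounding down costs at most 1/M for each of the at most k products, and these errors
    add up because all factors are at most 1; the final inversion is
    1-Lipschitz and is rounded once more. *)
Lemma approx_step_error (R : realType) (M t : nat) (G : sgraph)
    (H : {set 'I_(nnodes G)}) v k (e : R) : (0 < M)%N -> ~~ odd M -> v \in H ->
  (size (children H v) <= k)%N ->
  `|(1 + \prod_(w <- children H v) ((approx M t (rest H v w) w)%:R / M%:R))^-1
    - vacancy R H v| <= e ->
  `|(approx M t.+1 H v)%:R / M%:R - vacancy R H v| <= e + (k.+1)%:R / M%:R.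
Proof.
move=> M0 Meven vH sk; have M0' : 0 < M%:R :> R by rewrite ltr0n.
have := foldl_round_mul R (children H v) M0
  (fun w => approx_le M t (rest H v w) w).
rewrite /=; move: (foldl _ _ _) => P.
set X := \prod_(_ <- _) _ => PX Xq.
have X0 : 0 <= X by apply: prodr_ge0 => w _; rewrite divr_ge0.
have P0 : 0 <= P%:R / M%:R :> R by rewrite divr_ge0.
have PX' := le_trans (inv1D_lipschitz P0 X0) PX.
have := divn_floor R (M * M) (ltn_addr P M0); rewrite -/(round_inv M P).
have -> : (M * M)%:R / (M + P)%:R = (1 + P%:R / M%:R)^-1 * M%:R :> R.
  have -> : 1 + P%:R / M%:R = (M + P)%:R / M%:R :> R.
    by rewrite natrD mulrDl divff // gt_eqF.
  by rewrite invf_div natrM mulrAC.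
rewrite -natr1 mulrDl; set y := (round_inv _ _)%:R; set q := (_^-1) in PX' *.
move=> hy.
have yq : `|y / M%:R - q| <= 1 / M%:R.
  have -> : y / M%:R - q = (y - q * M%:R) / M%:R.
    by rewrite mulrBl mulfK ?gt_eqF.
  rewrite normrM normfV (ger0_norm (ltW M0')) ler_wpM2r // ?invr_ge0 ?ler0n.
  by rewrite ler_norml; lra.
have sk' : (size (children H v))%:R / M%:R <= k%:R / M%:R :> R.
  by rewrite ler_wpM2r // ?invr_ge0 ?ler0n ler_nat.
move: Xq PX' yq; rewrite !ler_norml; set Xi := (1 + X)^-1; lra.
Qed.

(** With at most three children a step multiplies the error by 24/25 and adds
    4/M, and 100/M is the fixed point of this: 24/25 * 100 + 4 = 100.  The 1/2
    is the length of the interval in which all vacancies lie. *)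
Lemma approx_error (R : realType) (M t : nat) (G : sgraph)
    (H : {set 'I_(nnodes G)}) v : (0 < M)%N -> ~~ odd M ->
  (max_degree G <= 4)%N -> v \in H -> (size (children H v) <= 3)%N ->
  `|(approx M t H v)%:R / M%:R - vacancy R H v|
    <= (24 / 25) ^+ t / 2 + 100 / M%:R.
Proof.
move=> M0 Meven deg4; have M0' : 0 < M%:R :> R by rewrite ltr0n.
have Mi0 : 0 < M%:R^-1 :> R by rewrite invr_gt0.
elim: t H v => [|t IH] H v vH s3.
  rewrite /= divff ?gt_eqF // expr0; have := vacancy_itv R vH.
  by rewrite ler_norml; lra.
have k0 : 0 <= (24 / 25) ^+ t :> R by apply: exprn_ge0; lra.
pose e : R := (24 / 25) ^+ t / 2 + 100 / M%:R.
apply: (le_trans (approx_step_error (e := 24 / 25 * e) M0 Meven vH s3 _));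
  last by rewrite exprS /e; lra.
rewrite vacancy_rec //; apply: inv1D_contracting => // [w|w wc|w wc|].
- by move=> _; apply: approx_itv.
- exact/vacancy_itv/children_rest.
- apply: IH; first exact: children_rest.
  by rewrite -ltnS (leq_trans (size_children_rest _ wc)).
- by rewrite /e; lra.
Qed.

(** The first node has not lost a neighbour and may have four children, for
    which there is no contraction; but four times the error of the children is
    good enough for a single step. *)
Lemma approx_root_error (R : realType) (M t : nat) (G : sgraph)
    (H : {set 'I_(nnodes G)}) v : (0 < M)%N -> ~~ odd M ->
  (max_degree G <= 4)%N -> v \in H ->
  `|(approx M t.+1 H v)%:R / M%:R - vacancy R H v|
    <= 2 * (24 / 25) ^+ t + 405 / M%:R.
Proof.
move=> M0 Meven deg4 vH; have M0' : 0 < M%:R :> R by rewrite ltr0n.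
have Mi0 : 0 < M%:R^-1 :> R by rewrite invr_gt0.
have k0 : 0 <= (24 / 25) ^+ t :> R by apply: exprn_ge0; lra.
have s4 := leq_trans (size_children H v) deg4.
pose e : R := (24 / 25) ^+ t / 2 + 100 / M%:R.
have e0 : 0 <= e by rewrite /e; lra.
apply: (le_trans (approx_step_error (e := 4 * e) M0 Meven vH s4 _));
  last by rewrite /e; lra.
rewrite vacancy_rec //.
have fh (w : 'I_(nnodes G)) : 0 <= ((approx M t (rest H v w) w)%:R / M%:R : R) <= 1.
  by have := approx_itv R t (rest H v w) w M0 Meven; lra.
have vh w : w \in children H v -> 0 <= vacancy R (rest H v w) w <= 1.
  by move/children_rest/(vacancy_itv R); lra.
apply: (le_trans (inv1D_lipschitz _ _)).
- by apply: prodr_ge0 => w _; case/andP: (fh w).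
- by rewrite big_seq; apply: prodr_ge0 => w /vh/andP[].
apply: (le_trans (prod_dist (d := e) _ _ _)) => // [w wc|].
  apply: approx_error => //; first exact: children_rest.
  by rewrite -ltnS (leq_trans (size_children_rest _ wc)).
by rewrite ler_wpM2r // ler_nat.
Qed.

(** At most four factors, each at least 1/2, enter the recursion. *)
Lemma vacancy_le1617 (R : realType) (G : sgraph) (H : {set 'I_(nnodes G)}) v :
  (max_degree G <= 4)%N -> v \in H -> vacancy R H v <= 16 / 17.
Proof.
move=> deg4 vH; have s4 := leq_trans (size_children H v) deg4.
rewrite vacancy_rec //; set P := \prod_(_ <- _) _.
suff P16 : 1 / 16 <= P.
  by rewrite -[leRHS]invrK lef_pV2 ?posrE; lra.
have half s : {subset s <= children H v} ->
    (1 / 2) ^+ size s <= \prod_(w <- s) vacancy R (rest H v w) w.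
  elim: s => [|w s IH] sub; first by rewrite big_nil expr0.
  rewrite big_cons exprS; apply: ler_pM.
  - lra.
  - by apply: exprn_ge0; lra.
  - by have /children_rest/(vacancy_itv R)/andP[] := sub _ (mem_head _ _).
  - by apply: IH => x xs; apply: sub; rewrite inE xs orbT.
have := half _ (fun w wc => wc).
apply: le_trans; apply: (@le_trans _ _ ((1 / 2) ^+ 4)); first lra.
by rewrite ler_wiXn2l //; lra.
Qed.

Lemma ln_vacancy_ge (R : realType) (G : sgraph) (H : {set 'I_(nnodes G)}) v :
  (max_degree G <= 4)%N -> v \in H -> 1 / 17 <= - ln (vacancy R H v).
Proof.
move=> deg4 vH; have := vacancy_le1617 R deg4 vH.
have /andP[] := vacancy_itv R vH; move: (vacancy R H v) => q q2 _ q17.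
rewrite lerNr; have -> : q = 1 + (q - 1) by lra.
by apply: (le_trans (le_ln1Dx _)); lra.
Qed.

Lemma ln_dist (R : realType) (x y : R) : 1 / 2 <= x -> 1 / 2 <= y ->
  `|ln x - ln y| <= 2 * `|x - y|.
Proof.
suff half (a b : R) : 1 / 2 <= a -> 1 / 2 <= b -> ln a - ln b <= 2 * `|a - b|.
  move=> x2 y2; rewrite ler_norml half // andbT lerNl opprB distrC.
  exact: half.
move=> a2 b2; have b0 : 0 < b by lra.
have a0 : 0 < a by lra.
rewrite -ln_div ?posrE //.
have -> : a / b = 1 + (a - b) / b by rewrite mulrBl divff ?gt_eqF //; lra.
have ab : 0 < a / b by rewrite divr_gt0.
apply: (le_trans (le_ln1Dx _)).
  by rewrite mulrBl divff ?gt_eqF //; lra.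
apply: (le_trans (ler_norm _)); rewrite normrM mulrC ler_wpM2r //.
by rewrite normfV gtr0_norm // -[leRHS]invrK lef_pV2 ?posrE; lra.
Qed.

Definition from (G : sgraph) (m : nat) : {set 'I_(nnodes G)} :=
  [set x : 'I_(nnodes G) | (m <= x)%N]%SET.

(** The product of the vacancies telescopes to 1 / Z(G). *)
Lemma ln_partition_function (R : realType) (G : sgraph) :
  ln (partition_function (1 : R) G) =
    \sum_(v : 'I_(nnodes G)) - ln (vacancy R (from G v) v).
Proof.
have ZE : partition_function (1 : R) G = #|indeps_in (from G 0)|%:R.
  rewrite /partition_function (eq_bigr (fun=> 1)) => [|I _]; last exact: expr1n.
  rewrite sumr_const; congr (_%:R); apply: eq_card => I; rewrite [in RHS]inE.
  suff -> : I \subset from G 0 by rewrite andbT.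
  by apply/fintype.subsetP => x _; rewrite inE.
have Zn : #|indeps_in (from G (nnodes G))| = 1%N.
  apply/eqP; rewrite eqn_leq indeps_in_gt0 andbT -(cards1 (@finset.set0 'I_(nnodes G))).
  apply/subset_leq_card/fintype.subsetP => I; rewrite !inE => /andP[_ IH].
  rewrite -finset.subset0; apply: fintype.subset_trans IH _.
  by apply/fintype.subsetP => x; rewrite !inE leqNgt ltn_ord.
rewrite {}ZE; have Zgt0 m : 0 < #|indeps_in (from G m)|%:R :> R.
  by rewrite ltr0n indeps_in_gt0.
suff tele m : (m <= nnodes G)%N ->
    \sum_(v <- take m (enum 'I_(nnodes G))) - ln (vacancy R (from G v) v) =
    ln #|indeps_in (from G 0)|%:R - ln #|indeps_in (from G m)|%:R.
  rewrite -[RHS]big_enum -[enum _]take_size size_enum_ord tele // Zn.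
  by rewrite ln1 subr0.
elim: m => [_|m IH mn]; first by rewrite take0 big_nil subrr.
have sm : (m < size (enum 'I_(nnodes G)))%N by rewrite size_enum_ord.
pose w0 := Ordinal mn.
rewrite (take_nth w0 sm) -cats1 big_cat big_seq1 /= IH 1?ltnW //.
have := nth_enum_ord w0 mn; move: (nth w0 _ m) => w wm.
rewrite wm /vacancy.
have -> : from G m :\ w = from G m.+1.
  by apply/finset.setP => x; rewrite !inE -wm ltn_neqAle eq_sym.
by rewrite ln_div ?posrE //; lra.
Qed.

(** * Reasoning about programs *)

Local Open Scope nat_scope.

(** Total correctness with a time bound.  Carrying the postcondition as a
    continuation turns the verification of straight-line code into symbolic
    execution. *)
Definition wp (c : cmd) (T : nat) (s : state) (Q : state -> Prop) : Prop :=
  exists t s', [/\ exec c s t s', t <= T & Q s'].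

Lemma wp_mono c T T' s (Q Q' : state -> Prop) :
  wp c T s Q -> T <= T' -> (forall s', Q s' -> Q' s') -> wp c T' s Q'.
Proof.
move=> [t [s' [ex tT Qs]]] TT QQ; exists t, s'; split => //; last exact: QQ.
exact: leq_trans TT.
Qed.

Lemma wp_le c T T' s Q : wp c T s Q -> T <= T' -> wp c T' s Q.
Proof. by move=> w TT; apply: wp_mono w TT _. Qed.

Lemma wp_skip s (Q : state -> Prop) : Q s -> wp Skip 1 s Q.
Proof. by exists 1, s; split => //; constructor. Qed.

Lemma wp_const r k s (Q : state -> Prop) :
  Q (set_reg s r k) -> wp (Const r k) 1 s Q.
Proof. by exists 1; eexists; split; first exact: ExecConst. Qed.

Lemma wp_add r r1 r2 s (Q : state -> Prop) :
  Q (set_reg s r (regs s r1 + regs s r2)) -> wp (Add r r1 r2) 1 s Q.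
Proof. by exists 1; eexists; split; first exact: ExecAdd. Qed.

Lemma wp_sub r r1 r2 s (Q : state -> Prop) :
  Q (set_reg s r (regs s r1 - regs s r2)) -> wp (Defs.Sub r r1 r2) 1 s Q.
Proof. by exists 1; eexists; split; first exact: ExecSub. Qed.

Lemma wp_fetch r r1 s (Q : state -> Prop) :
  Q (set_reg s r (cells s (regs s r1))) -> wp (Fetch r r1) 1 s Q.
Proof. by exists 1; eexists; split; first exact: ExecFetch. Qed.

Lemma wp_seq c1 c2 T1 T2 s Q :
  wp c1 T1 s (fun s' => wp c2 T2 s' Q) -> wp (Seq c1 c2) (T1 + T2) s Q.
Proof.
move=> [t1 [s1 [ex1 le1 [t2 [s2 [ex2 le2 Q2]]]]]].
exists (t1 + t2), s2; split => //; first exact: ExecSeq ex1 ex2.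
exact: leq_add.
Qed.

Lemma wp_if r c1 c2 T1 T2 s Q :
  (regs s r != 0 -> wp c1 T1 s Q) -> (regs s r = 0 -> wp c2 T2 s Q) ->
  wp (If r c1 c2) (T1 + T2).+1 s Q.
Proof.
move=> h1 h2; have [r0|r0] := eqVneq (regs s r) 0.
  have [t [s' [ex le Qs]]] := h2 r0.
  exists t.+1, s'; split => //; first exact: ExecIfF.
  by rewrite ltnS (leq_trans le) // leq_addl.
have [t [s' [ex le Qs]]] := h1 r0.
exists t.+1, s'; split => //; first exact: ExecIfT.
by rewrite ltnS (leq_trans le) // leq_addr.
Qed.

(** The invariant is indexed by the number k of completed rounds, while the
    guard register counts the remaining ones down. *)
Lemma wp_for g c T n (I : nat -> state -> Prop) s :
  (forall k s', I k s' -> regs s' g = n - k) ->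
  (forall k s', k < n -> I k s' -> wp c T s' (I k.+1)) ->
  I 0 s -> wp (While g c) (n * T.+1).+1 s (I n).
Proof.
move=> guard body.
suff loop m k s' : k + m = n -> I k s' -> wp (While g c) (m * T.+1).+1 s' (I n).
  exact: loop.
elim: m k s' => [|m IH] k s' kn Is.
  move: kn Is; rewrite addn0 => -> Is; exists 1, s'; split => //.
  by apply: ExecWhileF; rewrite (guard _ _ Is) subnn.
have kn' : k < n by rewrite -kn addnS ltnS leq_addr.
have [t1 [s1 [ex1 le1 I1]]] := body k s' kn' Is.
have [|t2 [s2 [ex2 le2 I2]]] := IH k.+1 s1 _ I1; first by rewrite addSnnS.
exists (t1 + t2).+1, s2; split => //.
  apply: ExecWhileT ex1 ex2.
  by rewrite (guard _ _ Is) -lt0n subn_gt0.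
by rewrite ltnS mulSn addSn -addnS leq_add.
Qed.

Lemma regs_set s r k x :
  regs (set_reg s r k) x = if x == r then k else regs s x.
Proof. by []. Qed.

Lemma cells_set s r k : cells (set_reg s r k) = cells s.
Proof. by []. Qed.

Lemma set_reg_set s r k k' : set_reg (set_reg s r k) r k' = set_reg s r k'.
Proof.
rewrite /set_reg /=; congr State; apply/funext => x /=.
by case: eqP.
Qed.

(** Register 1 is supposed to hold the constant 1.  The register r is counted
    down to 0 while k keeps track of what has been subtracted, so that the branch
    that is finally taken knows the original value; in effect r := f r. *)
Fixpoint lookup (r k m : nat) (f : nat -> nat) : cmd :=
  if m is m'.+1 then
    If r (Seq (Defs.Sub r r 1) (lookup r k.+1 m' f)) (Const r (f k))
  else Const r (f k).

Lemma wp_lookup r k m f s (Q : state -> Prop) :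
  r != 1 -> regs s 1 = 1 -> regs s r <= m ->
  Q (set_reg s r (f (k + regs s r))) -> wp (lookup r k m f) (3 * m).+1 s Q.
Proof.
move=> r1; elim: m k s => [|m IH] k s s1 rm Qs.
  apply: wp_const; move: Qs; move: rm; rewrite leqn0 => /eqP ->.
  by rewrite addn0.
apply: wp_le.
  apply: wp_if => [r0|r0].
    apply: wp_seq; apply: wp_sub; apply: IH.
    - by rewrite regs_set eq_sym (negbTE r1).
    - by rewrite regs_set eqxx s1 leq_subLR.
    - move: Qs; rewrite set_reg_set regs_set eqxx s1.
      by rewrite subn1 addSnnS prednK // lt0n.
  by apply: wp_const; rewrite r0 addn0 in Qs.
by lia.
Qed.

(** A pair of numbers up to m is coded as one number in base m + 1. *)
Definition lookup2 (r r' m : nat) (f : nat -> nat -> nat) : cmd :=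
  Seq (lookup r 0 m (muln m.+1)) (
  Seq (Add r r r')
      (lookup r 0 (m.+1 * m + m) (fun k => f (k %/ m.+1) (k %% m.+1)))).

Lemma wp_lookup2 r r' m f s (Q : state -> Prop) :
  r != 1 -> r' != r -> regs s 1 = 1 -> regs s r <= m -> regs s r' <= m ->
  Q (set_reg s r (f (regs s r) (regs s r'))) ->
  wp (lookup2 r r' m f) (3 * (m.+1 * m + m) + 3 * m + 3) s Q.
Proof.
move=> r1 rr s1 rm rm' Qs; apply: wp_le.
  apply: wp_seq; apply: wp_lookup => //.
  apply: wp_seq; apply: wp_add.
  rewrite set_reg_set !regs_set eqxx (negbTE rr) add0n.
  apply: wp_lookup => //.
  - by rewrite regs_set eq_sym (negbTE r1).
  - by rewrite regs_set eqxx leq_add // leq_mul2l rm.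
  - rewrite set_reg_set regs_set eqxx add0n mulnC divnMDl // modnMDl.
    by rewrite divn_small // addn0 modn_small.
by lia.
Qed.

(** Registers 0 to 4 are global: the number of nodes, the constant 1, the two
    parts of the output, and the guard of the main loop.  Registers 5 to 9 are
    scratch space: argument and result of a membership test, two temporaries, and
    the value of a vacancy.  From register 10 on, each level of the recursion
    owns a block of four, and b is the first register that may be overwritten. *)
Definition frame (b : nat) (s s' : state) : Prop :=
  cells s' = cells s /\
  forall r, r < 5 \/ 10 <= r < b -> regs s' r = regs s r.

Lemma frame_trans b s1 s2 s3 : frame b s1 s2 -> frame b s2 s3 -> frame b s1 s3.
Proof.
move=> [c12 r12] [c23 r23]; split=> [|r rb]; first by rewrite c23.
by rewrite r23 // r12.
Qed.

Lemma frame_weak b b' s s' : b' <= b -> frame b s s' -> frame b' s s'.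
Proof.
move=> bb [c r]; split=> // x xb; apply: r; lia.
Qed.

Lemma nth_allpairs (S T U : Type) (f : S -> T -> U) s t x0 y0 z0 i j :
  i < size s -> j < size t ->
  nth z0 [seq f x y | x <- s, y <- t] (i * size t + j)
    = f (nth x0 s i) (nth y0 t j).
Proof.
elim: s i => // x s IH [|i] si tj.
  by rewrite /= nth_cat size_map tj (nth_map y0).
rewrite /= nth_cat size_map mulSn -addnA ltnNge leq_addr /= addKn.
exact: IH.
Qed.

Lemma cells_input (G : sgraph) (x y : 'I_(nnodes G)) :
  cells (input G) (x * nnodes G + y) = edge x y.
Proof.
have := @nth_allpairs _ _ _ (fun x y => nat_of_bool (edge x y))
  (enum 'I_(nnodes G)) (enum 'I_(nnodes G)) x y 0 x y.
by rewrite size_enum_ord !nth_ord_enum; apply.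
Qed.

Definition test_frame (s s' : state) : Prop :=
  cells s' = cells s /\ forall r, r < 6 \/ 8 < r -> regs s' r = regs s r.

(** The set H in which a level of the recursion works is determined by the nodes
    stored in the blocks of the levels above.  So it need not be kept in memory:
    a command deciding membership in H is built along with the program.  It has
    to work in every state that differs from s0 in scratch space and from
    register b on only. *)
Definition tests (G : sgraph) (b T : nat) (test : cmd) (s0 : state)
    (H : {set 'I_(nnodes G)}) : Prop :=
  forall s (x : 'I_(nnodes G)), frame b s0 s -> regs s 5 = x ->
  wp test T s (fun s' => regs s' 6 = (x \in H) /\ test_frame s s').

(** Built from the definition of [rest]: b holds v, b + 1 the address of the row
    of v in the adjacency matrix, and b + 4 the neighbour w. *)
Definition test_rest (b : nat) (test : cmd) : cmd :=
  Seq test (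
  Seq (Add 7 b.+1 5) (
  Seq (Fetch 7 7) (
  Seq (Defs.Sub 8 b.+4 5) (
  Seq (If 7 (If 8 (Const 6 0) Skip) Skip) (
  Seq (Defs.Sub 7 b 5) (
  Seq (Defs.Sub 8 5 b) (
  Seq (Add 7 7 8) (
  If 7 Skip (Const 6 0))))))))).

(** Decides which registers coincide; their numbers are of the form b + constant,
    with b at least 10. *)
Ltac reg_simp :=
  rewrite ?cells_set;
  repeat first [rewrite regs_set | case: eqP => [?|?]; try (exfalso; lia)].

Lemma tests_rest (G : sgraph) (b T : nat) (test : cmd) (s0 s1 : state)
    (H : {set 'I_(nnodes G)}) (v w : 'I_(nnodes G)) :
  10 <= b -> tests b.+2 T test s0 H -> frame b.+2 s0 s1 ->
  cells s1 = cells (input G) ->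
  regs s1 b = v -> regs s1 b.+1 = v * nnodes G -> regs s1 b.+4 = w ->
  tests b.+4.+2 (T + 20) (test_rest b test) s1 (rest H v w).
Proof.
move=> b10 testH s01 c1 s1v s1vn s1w s x fr sx.
apply: wp_le.
  apply: wp_seq; apply: wp_mono (leqnn _) _.
    by apply: testH sx; apply: frame_trans s01 (frame_weak _ fr); lia.
  move=> s2 [s26 [c2 fr2]].
  have [cf rf] := fr.
  have s2v : regs s2 b = v by rewrite fr2 ?rf //; lia.
  have s2vn : regs s2 b.+1 = v * nnodes G by rewrite fr2 ?rf //; lia.
  have s2w : regs s2 b.+4 = w by rewrite fr2 ?rf //; lia.
  have s2x : regs s2 5 = x by rewrite fr2 //; lia.
  apply: wp_seq; apply: wp_add; apply: wp_seq; apply: wp_fetch.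
  apply: wp_seq; apply: wp_sub.
  set s3 := set_reg _ _ _.
  have s37 : regs s3 7 = edge v x.
    by rewrite /s3 /= c2 cf c1 s2vn s2x cells_input.
  have s38 : regs s3 8 = w - x.
    by rewrite /s3; reg_simp; rewrite s2w s2x.
  have s36 : regs s3 6 = (x \in H) by [].
  have s3r r : r < 6 \/ 8 < r -> regs s3 r = regs s r.
    by move=> hr; rewrite /s3; reg_simp; apply: fr2.
  have c3 : cells s3 = cells s by [].
  move: s3 s37 s38 s36 s3r c3 => s3 s37 s38 s36 s3r c3.
  apply: wp_seq.
  apply: (@wp_mono _ _ _ _ (fun s' =>
    regs s' 6 = ((x \in H) && ~~ (edge v x && (x < w))) /\ test_frame s s')
    _ _ (leqnn _)).
    apply: wp_if => h7.
      have vx : edge v x by move: h7; rewrite s37; case: edge.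
      rewrite vx; apply: wp_if => h8.
        apply: wp_const; split; last first.
          by split=> // r hr; reg_simp; apply: s3r.
        by rewrite /= -subn_gt0 lt0n -s38 h8 andbF.
      apply: wp_skip; split; last by split.
      by rewrite s36 -subn_gt0 lt0n -s38 h8 andbT.
    apply: wp_skip; split; last by split.
    by move: h7; rewrite s37 s36; case: edge => //; rewrite andbT.
  move=> s4 [s46 [c4 r4]].
  apply: wp_seq; apply: wp_sub; apply: wp_seq; apply: wp_sub.
  apply: wp_seq; apply: wp_add.
  set s5 := set_reg _ _ _.
  have s57 : regs s5 7 = (v - x) + (x - v).
    have s4v : regs s4 b = v by rewrite r4 ?rf //; lia.
    have s4x : regs s4 5 = x by rewrite r4 //; lia.
    by rewrite /s5; reg_simp; rewrite s4v s4x.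
  have s5r r : r < 7 \/ 8 < r -> regs s5 r = regs s4 r.
    by move=> hr; rewrite /s5; reg_simp.
  have c5 : cells s5 = cells s by [].
  have xv : (x != v) = (regs s5 7 != 0).
    have ne (i j : nat) : (i != j) = (j - i + (i - j) != 0) by lia.
    by rewrite s57 -ne.
  move: s5 s57 s5r c5 xv => s5 s57 s5r c5 xv.
  apply: wp_if => h7.
    apply: wp_skip; split; last first.
      by split=> // r hr; rewrite s5r ?r4 //; lia.
    by rewrite s5r ?s46 ?inE ?xv ?h7 //; left.
  apply: wp_const; split; last first.
    by split=> // r hr; reg_simp; rewrite s5r ?r4 //; lia.
  by rewrite /= inE xv h7 andbF.
by lia.
Qed.

(** * The program *)

(** Block of a level: v, v * n, the product so far, the loop guard.  The loop
    variable w and w * n sit in the first two registers of the next block, so that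
    the recursive call finds its argument in place. *)
Fixpoint vacancy_prog (M t b : nat) (test : cmd) : cmd :=
  if t is t'.+1 then
    Seq (Const b.+2 M) (
    Seq (Const b.+3 0) (
    Seq (Add b.+3 b.+3 0) (
    Seq (Const b.+4 0) (
    Seq (Const b.+4.+1 0) (
    Seq (While b.+3 (
      Seq (Const 5 0) (
      Seq (Add 5 5 b.+4) (
      Seq test (
      Seq (Add 7 b.+1 b.+4) (
      Seq (Fetch 7 7) (
      Seq (If 7 (If 6 (
        Seq (vacancy_prog M t' b.+4 (test_rest b test))
            (lookup2 b.+2 9 M (round_mul M))) Skip) Skip) (
      Seq (Add b.+4 b.+4 1) (
      Seq (Add b.+4.+1 b.+4.+1 0)
          (Defs.Sub b.+3 b.+3 1)))))))))) (
    Seq (Const 9 0) (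
    Seq (Add 9 9 b.+2)
        (lookup 9 0 M (round_inv M)))))))))
  else Const 9 M.

(** T bounds the time of the membership test, which gains at most 20 steps from
    one level to the next. *)
Fixpoint vacancy_time (M n t T : nat) : nat :=
  if t is t'.+1 then
    n * (T + vacancy_time M n t' (T + 20) + 3 * (M.+1 * M + M) + 3 * M + 20).+1
      + 3 * M + 20
  else 1.

Lemma vacancy_prog_ok (M t : nat) (G : sgraph) b test T (H : {set 'I_(nnodes G)})
    (v : 'I_(nnodes G)) s :
  10 <= b -> regs s 0 = nnodes G -> regs s 1 = 1 -> cells s = cells (input G) ->
  regs s b = v -> regs s b.+1 = v * nnodes G -> tests b.+2 T test s H ->
  wp (vacancy_prog M t b test) (vacancy_time M (nnodes G) t T) s
    (fun s' => frame b.+2 s s' /\ regs s' 9 = approx M t H v).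
Proof.
elim: t b test T H v s => [|t IH] b test T H v s b10 s0 s1 sc sv svn testH.
  by apply: wp_const; split=> //; split=> // r hr; reg_simp.
pose step P (w : 'I_(nnodes G)) := round_mul M P (approx M t (rest H v w) w).
pose pre k := [seq w <- take k (enum 'I_(nnodes G)) | edge v w && (w \in H)].
pose Inv k s' := frame b.+2 s s' /\
  [/\ regs s' b.+2 = foldl step M (pre k), regs s' b.+3 = nnodes G - k,
      regs s' b.+4 = k & regs s' b.+4.+1 = k * nnodes G].
rewrite [vacancy_prog _ _ _ _]/=; apply: wp_le.
  do 5 (apply: wp_seq; first [apply: wp_const|apply: wp_add]).
  set s2 := set_reg _ _ _.
  have I0 : Inv 0 s2.
    rewrite /Inv; split.
      by split=> // r hr; rewrite /s2; reg_simp.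
    by rewrite /pre take0 /= subn0 mul0n; split; reg_simp.
  move: s2 I0 => s2 I0.
  apply: wp_seq; apply: wp_mono (leqnn _) _.
    apply: (wp_for (n := nnodes G) (I := Inv) (T := T + vacancy_time M (nnodes G) t
      (T + 20) + 3 * (M.+1 * M + M) + 3 * M + 20)) I0 => [k s' [_ []] //|k s' kn].
    move=> [[fc fr] [sP sg sw swn]].
    have [w wk] : exists w : 'I_(nnodes G), w = k :> nat by exists (Ordinal kn).
    apply: wp_le.
      do 2 (apply: wp_seq; first [apply: wp_const|apply: wp_add]).
      set s3 := set_reg _ _ _.
      have fs3 : frame b.+2 s s3.
        by split=> // r hr; rewrite /s3; reg_simp; apply: fr.
      have s35 : regs s3 5 = w by rewrite /s3; reg_simp; rewrite sw wk.
      have s3r r : 10 <= r -> regs s3 r = regs s' r.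
        by move=> hr; rewrite /s3; reg_simp.
      move: s3 fs3 s35 s3r => s3 fs3 s35 s3r.
      apply: wp_seq; apply: wp_mono (testH s3 w fs3 s35) (leqnn _) _.
      move=> s4 [s46 [c4 r4]].
      have c4i : cells s4 = cells (input G) by rewrite c4 fs3.1.
      have fs4 : frame b.+2 s s4.
        apply: (frame_trans fs3); split=> // r hr; apply: r4; lia.
      have s4r r : 10 <= r -> regs s4 r = regs s' r.
        by move=> hr; rewrite r4 ?s3r //; lia.
      apply: wp_seq; apply: wp_add; apply: wp_seq; apply: wp_fetch.
      set s5 := set_reg _ _ _.
      have fs5 : frame b.+2 s s5.
        apply: (frame_trans fs4); split=> // r hr; rewrite /s5; reg_simp.
        by [].
      have s57 : regs s5 7 = edge v w.
        rewrite /s5 /= c4i !s4r ?sw ?fr ?svn -?wk; try lia.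
        exact: cells_input.
      have s56 : regs s5 6 = (w \in H) by [].
      have s5r r : 10 <= r -> regs s5 r = regs s' r.
        by move=> hr; rewrite /s5; reg_simp; apply: s4r.
      move: s5 fs5 s57 s56 s5r => s5 fs5 s57 s56 s5r.
      apply: wp_seq.
      (* What holds after the conditional, whichever branch is taken. *)
      pose mid s6 := frame b.+2 s s6 /\ regs s6 b.+2 = foldl step M (pre k.+1)
        /\ forall r, b.+3 <= r <= b.+4.+1 -> regs s6 r = regs s' r.
      have preS : pre k.+1 =
          if edge v w && (w \in H) then rcons (pre k) w else pre k.
        rewrite /pre (take_nth w) ?size_enum_ord // filter_rcons.
        by rewrite -wk nth_ord_enum.
      apply: (@wp_mono _ _ _ _ mid _ _ (leqnn _)).
        apply: wp_if => h7.
          have vw : edge v w by move: h7; rewrite s57; case: edge.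
          apply: wp_if => h6.
            have wH : w \in H by move: h6; rewrite s56; case: (w \in H).
            apply: wp_seq; apply: wp_mono (leqnn _) _.
              apply: (IH b.+4 _ (T + 20) (rest H v w) w).
              - lia.
              - by rewrite fs5.2 //; left.
              - by rewrite fs5.2 //; left.
              - by rewrite fs5.1.
              - rewrite s5r ?sw //; lia.
              - rewrite s5r ?swn ?wk //; lia.
              - apply: (tests_rest b10 testH fs5) => //.
                + by rewrite fs5.1.
                + rewrite s5r ?fr //; lia.
                + rewrite s5r ?fr //; lia.
                + rewrite s5r ?sw //; lia.
            move=> s6 [[c6 r6] s69].
            have s6P : regs s6 b.+2 = foldl step M (pre k).
              rewrite r6 ?s5r ?sP //; lia.
            have PM : foldl step M (pre k) <= M.
              by apply: foldl_round_mul_le => // x; apply: approx_le.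
            have s61 : regs s6 1 = 1 by rewrite r6 ?fs5.2 //; left.
            apply: wp_lookup2 => //.
            - by rewrite neq_ltn; apply/orP; left; lia.
            - by rewrite s6P.
            - by rewrite s69 approx_le.
            - rewrite s6P s69; split.
                apply: (frame_trans fs5); split=> // r hr; reg_simp.
                apply: r6; lia.
              split.
                by rewrite regs_set eqxx preS vw wH foldl_rcons.
              by move=> r hr; reg_simp; rewrite r6 ?s5r //; lia.
          apply: wp_skip; split=> //; split; last by move=> r hr; apply: s5r; lia.
          move: h6; rewrite preS s56; case: (w \in H) => // _.
          by rewrite andbF s5r ?sP //; lia.
        apply: wp_skip; split=> //; split; last by move=> r hr; apply: s5r; lia.
        move: h7; rewrite preS s57; case: edge => // _.
        by rewrite s5r ?sP //; lia.
      move=> s6 [fs6 [s6P s6r]].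
      do 2 (apply: wp_seq; apply: wp_add); apply: wp_sub.
      have s61 : regs s6 1 = 1 by rewrite fs6.2 //; left.
      have s60 : regs s6 0 = nnodes G by rewrite fs6.2 //; left.
      rewrite /Inv; split.
        apply: (frame_trans fs6); split=> // r hr; reg_simp.
        by [].
      split; reg_simp.
      - by [].
      - by rewrite s61 s6r ?sg ?subnS ?subn1 //; lia.
      - by rewrite s61 s6r ?sw ?addn1 //; lia.
      - by rewrite s60 s6r ?swn ?mulSn 1?addnC //; lia.
    by move: (vacancy_time _ _ _ _) (M.+1 * M + M) => ? ?; lia.
  move=> s3 [fs3 [s3P _ _ _]].
  apply: wp_seq; apply: wp_const; apply: wp_seq; apply: wp_add.
  have PM : foldl step M (pre (nnodes G)) <= M.
    by apply: foldl_round_mul_le => // x; apply: approx_le.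
  apply: wp_lookup => //.
  - by reg_simp; rewrite fs3.2 //; left.
  - by reg_simp; rewrite s3P.
  - split.
      apply: (frame_trans fs3); split=> // r hr; reg_simp.
      by [].
    rewrite regs_set eqxx; reg_simp; rewrite s3P /pre take_oversize //.
    by rewrite size_enum_ord.
by rewrite /=; move: (nnodes G * _) => ?; lia.
Qed.

Lemma vacancy_time_poly (M t T : nat) :
  exists c, forall n, 0 < n -> vacancy_time M n t T <= c * n ^ t.
Proof.
elim: t T => [|t IH] T; first by exists 1 => n _; rewrite expn0.
have [c hc] := IH (T + 20).
exists (c + (T + 3 * (M.+1 * M + M) + 3 * M + 21) + (3 * M + 20)) => n n0 /=.
have := hc n n0; rewrite expnS.
move: (vacancy_time _ _ _ _) (n ^ t) (expn_gt0 n t) => p q; rewrite n0 /= => q0 pq.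
move: (M.+1 * M + M) => A.
have nq : 0 < n * q by rewrite muln_gt0 n0.
have np : n * p <= n * (c * q) by rewrite leq_mul2l pq orbT.
have nn : n <= n * q by rewrite leq_pmulr.
move: nq np nn; nia.
Qed.

Definition test_from : cmd := Seq (Defs.Sub 6 10 5) (Defs.Sub 6 1 6).

Lemma tests_from (G : sgraph) s (v : 'I_(nnodes G)) :
  regs s 1 = 1 -> regs s 10 = v -> tests 12 2 test_from s (from G v).
Proof.
move=> s1 sv s' x [fc fr] sx; apply: (@wp_le _ (1 + 1)) => //.
apply: wp_seq; apply: wp_sub; apply: wp_sub; split.
  have s'1 : regs s' 1 = 1 by rewrite fr //; left.
  have s'v : regs s' 10 = v by rewrite fr //; right.
  by reg_simp; rewrite s'1 s'v sx inE; case: leqP; lia.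
by split=> // r hr; reg_simp.
Qed.

Definition logZ_prog (M t : nat) (L : nat -> nat) : cmd :=
  Seq (Const 1 1) (
  Seq (Add 4 4 0) (
  Seq (While 4 (
    Seq (vacancy_prog M t 10 test_from) (
    Seq (lookup 9 0 M L) (
    Seq (Add 2 2 9) (
    Seq (Const 9 M) (
    Seq (Add 3 3 9) (
    Seq (Add 10 10 1) (
    Seq (Add 11 11 0)
        (Defs.Sub 4 4 1))))))))) (
  Seq (Const 0 0) (
  Seq (Add 0 0 2) (
  Seq (Const 1 0)
      (Add 1 1 3)))))).

Lemma logZ_prog_ok (M t : nat) (L : nat -> nat) (G : sgraph) :
  wp (logZ_prog M t L)
    (nnodes G * (vacancy_time M (nnodes G) t 2 + 3 * M + 10).+1 + 10) (input G)
    (fun s => regs s 0 = \sum_(v : 'I_(nnodes G)) L (approx M t (from G v) v)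
      /\ regs s 1 = nnodes G * M).
Proof.
pose n := nnodes G.
pose Inv k s := cells s = cells (input G) /\
  [/\ regs s 0 = n, regs s 1 = 1,
      regs s 2 = \sum_(v <- take k (enum 'I_n)) L (approx M t (from G v) v),
      regs s 3 = k * M & regs s 4 = n - k /\ regs s 10 = k /\ regs s 11 = k * n].
rewrite /logZ_prog; apply: wp_le.
  apply: wp_seq; apply: wp_const; apply: wp_seq; apply: wp_add.
  set s0 := set_reg _ _ _.
  have I0 : Inv 0 s0.
    split=> //; rewrite take0 big_nil mul0n; split; [..|split; [|split]]; reg_simp.
    all: rewrite /= ?subn0 //.
  move: s0 I0 => s0 I0; apply: wp_seq; apply: wp_mono (leqnn _) _.
    apply: (wp_for (n := n) (I := Inv) (T := vacancy_time M n t 2 + 3 * M + 10)) I0.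
      by move=> k s [_ [_ _ _ _ []]].
    move=> k s kn [sc [s0n s1 s2 s3 [s4 [s10 s11]]]].
    have [w wk] : exists w : 'I_(nnodes G), w = k :> nat by exists (Ordinal kn).
    apply: wp_le.
      apply: wp_seq; apply: wp_mono (leqnn _) _.
        apply: (@vacancy_prog_ok M t G 10 test_from 2 (from G w) w) => //.
        - by rewrite s10 wk.
        - by rewrite s11 wk.
        - by apply: tests_from; rewrite ?s10 ?wk.
      move=> s' [[c' r'] s9].
      apply: wp_seq; apply: wp_lookup => //.
      - by rewrite r' //; left.
      - by rewrite s9 approx_le.
      apply: wp_seq; apply: wp_add; apply: wp_seq; apply: wp_const.
      do 3 (apply: wp_seq; apply: wp_add); apply: wp_sub.
      have r0 : regs s' 0 = n by rewrite r' //; left.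
      have r1 : regs s' 1 = 1 by rewrite r' //; left.
      have r2 : regs s' 2 = regs s 2 by rewrite r' //; left.
      have r3 : regs s' 3 = k * M by rewrite r' //; left.
      have r4 : regs s' 4 = n - k by rewrite r' //; left.
      have r10 : regs s' 10 = k by rewrite r' //; right.
      have r11 : regs s' 11 = k * n by rewrite r' //; right.
      split; first by rewrite /= c' sc.
      split; [..|split; [|split]]; reg_simp => //.
      - rewrite s9 add0n (take_nth w) ?size_enum_ord // -cats1 big_cat big_seq1.
        by rewrite r2 s2 -wk nth_ord_enum.
      - by rewrite r3 mulSn addnC.
      - by rewrite r4 r1; lia.
      - by rewrite r10 r1 addn1.
      - by rewrite r11 r0 mulSn addnC.
    by rewrite /n; lia.
  move=> s [_ [s0n s1 s2 s3 _]].
  apply: wp_seq; apply: wp_const; apply: wp_seq; apply: wp_add.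
  apply: wp_seq; apply: wp_const; apply: wp_add.
  split; reg_simp; last by rewrite s3.
  by rewrite add0n s2 take_oversize ?size_enum_ord // big_enum.
by rewrite /n; move: (nnodes G * _) => ?; lia.
Qed.

(** * The approximation scheme *)

Local Open Scope ring_scope.

(** Bernoulli: (25/24)^t >= 1 + t/24. *)
Lemma exprn_small (R : realType) (e : R) : 0 < e ->
  exists t, (24 / 25) ^+ t <= e.
Proof.
move=> e0; have bernoulli t : (24 / 25) ^+ t * (1 + t%:R / 24) <= 1 :> R.
  elim: t => [|t IH]; first by rewrite expr0; lra.
  apply: le_trans IH; rewrite exprS -[t.+1%:R]natr1.
  have k0 : 0 <= (24 / 25) ^+ t :> R by apply: exprn_ge0; lra.
  have t0 : 0 <= t%:R :> R by [].
  have := mulr_ge0 k0 t0; lra.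
have [t te] : exists t, 24 / e <= t%:R.
  by exists (Num.truncn (24 / e)).+1; apply/ltW/truncnS_gt.
exists t.
have t0 : 0 <= t%:R :> R by [].
have := bernoulli t; rewrite -ler_pdivlMr; last by lra.
move/le_trans; apply; rewrite div1r.
rewrite -[leRHS]invrK lef_pV2 ?posrE ?invr_gt0 //; lra.
Qed.

(** The logarithms are never computed: finitely many values are constants of the
    program. *)
Definition log_table (R : realType) (M k : nat) : nat :=
  Num.truncn (M%:R * - ln (k%:R / M%:R : R)).

(** On [1/2, 1] the logarithm is 2-Lipschitz, which doubles the error
    2 * (24/25)^t + 405 / M of the vacancy; rounding adds 1 / M.  Since the true
    logarithm is at least 1/17 in absolute value, the absolute error e / 17 is a
    relative error e. *)
Lemma log_table_error (R : realType) (e : R) (M t : nat) (G : sgraph)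
    (H : {set 'I_(nnodes G)}) v : (0 < M)%N -> ~~ odd M ->
  4 * (24 / 25) ^+ t + 811 / M%:R <= e / 17 -> (max_degree G <= 4)%N ->
  v \in H ->
  `|(log_table R M (approx M t.+1 H v))%:R / M%:R - - ln (vacancy R H v)|
     <= e * - ln (vacancy R H v).
Proof.
move=> M0 Meven small deg4 vH; have M0' : 0 < M%:R :> R by rewrite ltr0n.
have Mi0 : 0 < M%:R^-1 :> R by rewrite invr_gt0.
have err := approx_root_error R t M0 Meven deg4 vH.
have /andP[a2 a1] := approx_itv R t.+1 H v M0 Meven.
have /andP[v2 v1] := vacancy_itv R vH.
have lnv := ln_vacancy_ge R deg4 vH.
rewrite /log_table; move: (_ / _) (vacancy R H v) err a2 a1 v2 v1 lnv.
move=> a q err a2 a1 q2 q1 lnq.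
have lna : 0 <= - ln a by rewrite oppr_ge0 ln_le0.
have := truncn_itv (mulr_ge0 (ltW M0') lna); rewrite -natr1.
set L := (Num.truncn _)%:R => /andP[L1 L2].
have La : `|L / M%:R - - ln a| <= 1 / M%:R.
  have -> : L / M%:R - - ln a = (L - M%:R * - ln a) / M%:R.
    by rewrite mulrBl [_ * - _]mulrC mulfK // gt_eqF.
  rewrite normrM [`|_^-1|]gtr0_norm //; apply: ler_wpM2r; first exact: ltW.
  by rewrite ler_norml; lra.
have aq := ln_dist a2 q2.
have e0 : 0 <= e.
  have : 0 <= (24 / 25) ^+ t :> R by apply: exprn_ge0; lra.
  lra.
have : 0 <= e * (- ln q - 1 / 17) by apply: mulr_ge0; lra.
move: La aq err; rewrite !ler_norml => /andP[La1 La2] /andP[aq1 aq2].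
set d := `|a - q| in aq1 aq2 *; move=> err.
have : d <= 2 * (24 / 25) ^+ t + 405 / M%:R by rewrite ler_norml.
lra.
Qed.

Theorem theorem1 (R : realType) (F : set sgraph)
    (Fdeg : forall G, F G -> (max_degree G <= 4)%N)
    (Fgirth : large_girth R F) :
  has_PAS (1 : R) F.
Proof.
move=> eps eps0.
(* Below 1, so that the lower bound already makes the output positive. *)
pose e := Num.min eps (1 / 2).
have e0 : 0 < e by rewrite lt_min eps0; lra.
have e2 : e <= 1 / 2 by rewrite ge_min lexx orbT.
have ee : e <= eps by rewrite ge_min lexx.
have [t te] : exists t, (24 / 25) ^+ t <= e / 200.
  by apply: exprn_small; lra.
have [M [M0 Meven Me]] : exists M, [/\ (0 < M)%N, ~~ odd M & 30 * 811 / e <= M%:R].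
  exists (Num.truncn (30 * 811 / e)).+1.*2.
  split; [by rewrite double_gt0|by rewrite odd_double|].
  apply: (le_trans (ltW (truncnS_gt _))).
  by rewrite ler_nat -addnn leq_addr.
have M0' : 0 < M%:R :> R by rewrite ltr0n.
(* The two summands are at most e / 50 and e / 30. *)
have small : 4 * (24 / 25) ^+ t + 811 / M%:R <= e / 17.
  suff : 30 * 811 / M%:R <= e by lra.
  by rewrite ler_pdivrMr // [e * _]mulrC -ler_pdivrMr.
have [c hc] := vacancy_time_poly M t.+1 2.
pose L := log_table R M.
exists (logZ_prog M t.+1 L), (c + 3 * M + 21)%N, t.+2 => G FG n0.
have [T [s [ex le [s0 s1]]]] := logZ_prog_ok M t.+1 L G.
exists T, s; split => //.
  apply: (leq_trans le); rewrite (expnS _ t.+1); have := hc _ n0.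
  move: (vacancy_time M _ _ _) => p; move: (nnodes G) n0 => n n0 pq.
  move: (n ^ t.+1)%N (expn_gt0 n t.+1) pq => q; rewrite n0 /= => q0 pq.
  have nq : (0 < n * q)%N by rewrite muln_gt0 n0.
  have np : (n * p <= n * (c * q))%N by rewrite leq_mul2l pq orbT.
  have nn : (n <= n * q)%N by rewrite leq_pmulr.
  move: nq np nn; nia.
rewrite /eps_approx /output s0 s1 ln_partition_function.
set V := \sum_(_ | _) - _; set n : R := (nnodes G)%:R.
have n0' : 0 < n by rewrite ltr0n.
have -> : (\sum_(v : 'I_(nnodes G)) L (approx M t.+1 (from G v) v))%:R /
    (nnodes G * M)%:R =
    (\sum_(v : 'I_(nnodes G)) (L (approx M t.+1 (from G v) v))%:R / M%:R) / n.
  by rewrite natr_sum natrM invfM [n^-1 * _]mulrC mulrA mulr_suml.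
set A := \sum_(_ | _) _.
have vfrom (v : 'I_(nnodes G)) : v \in from G v by rewrite inE.
have err v := log_table_error M0 Meven small (Fdeg _ FG) (vfrom v).
have AV1 : (1 - e) * V <= A.
  rewrite mulr_sumr; apply: ler_sum => v _.
  by have := err v; rewrite ler_norml; lra.
have AV2 : A <= (1 + e) * V.
  rewrite mulr_sumr; apply: ler_sum => v _.
  by have := err v; rewrite ler_norml; lra.
have V0 : 0 < V.
  apply: (@lt_le_trans _ _ (\sum_(v : 'I_(nnodes G)) (1 / 17))).
    by rewrite sumr_const card_ord pmulrn_lgt0 //; lra.
  by apply: ler_sum => v _; apply: ln_vacancy_ge (Fdeg _ FG) (vfrom v).
split.
- rewrite divr_gt0 //; apply: lt_le_trans AV1; apply: mulr_gt0 => //; lra.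
- rewrite mulrA ler_pM2r ?invr_gt0 //; apply: le_trans AV1.
  by rewrite ler_pM2r //; lra.
- rewrite mulrA ler_pM2r ?invr_gt0 //; apply: (le_trans AV2).
  by rewrite ler_pM2r //; lra.
Qed.
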